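(* Let $L>0$. Then $(\mathfrak{H};\sqrt L\,\omega,T_L,\phi,g_L)$ is a contact Riemannian structure on the Heisenberg group $\mathfrak{H}$ if and only if $L=1/4$.
   Context: $\mathfrak{H}=\mathbb{C}\times\mathbb{R}$ is the Heisenberg group with coordinates $(z=x+iy,t)$ and multiplication $(z,t)*(w,s)=(z+w,t+s+2\Im(z\overline w))$. Put $X=\partial_x+2y\,\partial_t$, $Y=\partial_y-2x\,\partial_t$, $T=\partial_t$, $\omega=dt+2x\,dy-2y\,dx$. For $L>0$ let $T_L=T/\sqrt L$, and let $g_L=dx^2+dy^2+L\omega^2$ be the Riemannian metric for which $\{X,Y,T_L\}$ is orthonormal. The endomorphism $\phi$ of $T(\mathfrak{H})$ is given by $\phi X=Y$, $\phi Y=-X$, $\phi T_L=0$. Contact Riemannian structure: on a $(2p+1)$-dimensional manifold $M$ with contact form $\eta$ and Reeb vector field $\xi$ ($\eta(\xi)=1$, $\xi\in\ker d\eta$), a tuple $(M;\eta,\xi,\phi,g_M)$ with $\phi$ an endomorphism of $T(M)$ and $g_M$ a Riemannian metric such that $\eta(U)=g_M(U,\xi)$, $\tfrac12 d\eta(U,V)=g_M(\phi U,V)$, $\phi^2U=-U+\eta(U)\xi$ for all vector fields $U,V$. Convention: $(\alpha\wedge\beta)(U,V)=\alpha(U)\beta(V)-\alpha(V)\beta(U)$, so that $d\omega(X,Y)=4$. *)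

(* Defs.v *)
From HB Require Import structures.
From mathcomp Require Import all_boot all_order all_algebra all_fingroup.
From mathcomp Require Import all_classical all_reals all_analysis.
From mathcomp Require Import ring.

Set Implicit Arguments.
Unset Strict Implicit.
Unset Printing Implicit Defensive.

Import Order.TTheory GRing.Theory Num.Theory.
Import numFieldNormedType.Exports.
Local Open Scope ring_scope.

(* The manifold is R^n with its global chart, so that every tangent space is
   identified with 'rV[R]_n; tensor fields take the base point as their first
   argument. *)

Section Tensors.
Variables (R : realType) (n : nat).
Notation E := 'rV[R]_n.

Fixpoint Ck (k : nat) (f : E -> R) : Prop :=
  if k is k'.+1 then
    (forall q, differentiable f q) /\
    (forall i : 'I_n, Ck k' (fun q => 'D_(delta_mx 0 i) f q))
  else continuous f.

Definition smooth (f : E -> R) : Prop := forall k, Ck k f.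

Definition vector_field (U : E -> E) : Prop :=
  forall j : 'I_n, smooth (fun q => U q 0 j).

Definition one_form (eta : E -> E -> R) : Prop :=
  (forall q, scalar (eta q)) /\ (forall v, smooth (fun q => eta q v)).

Definition endomorphism_field (phi : E -> E -> E) : Prop :=
  (forall q, linear (phi q)) /\ (forall v, vector_field (fun q => phi q v)).

Definition riemannian_metric (g : E -> E -> E -> R) : Prop :=
  [/\ forall q u, scalar (g q u),
      forall q u v, g q u v = g q v u,
      forall q u, u != 0 -> 0 < g q u u
    & forall u v, smooth (fun q => g q u v)].

(* u and v are extended to constant, hence commuting, vector fields; equal to
   \sum_(i, j) (d_i eta_j) dx_i /\ dx_j for the unnormalized wedge product. *)
Definition ext_d (eta : E -> E -> R) (q u v : E) : R :=
  'D_u (fun x => eta x v) q - 'D_v (fun x => eta x u) q.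

(* A k-covector is a function on k-tuples of tangent vectors (that it is
   alternating and multilinear is not recorded); the factor 1/(k! l!) gives (a /\ b)(u, v) = a u b v - a v b u for
   k = l = 1. *)
Definition multicovector (k : nat) := ('I_k -> E) -> R.

Definition wedge (k l : nat) (a : multicovector k) (b : multicovector l) :
    multicovector (k + l) := fun v =>
  (k`! * l`!)%:R^-1 *
  \sum_(s : 'S_(k + l)) (-1) ^+ s *
     a (fun i => v (s (lshift l i))) * b (fun j => v (s (rshift k j))).

Fixpoint wedge_pow (b : multicovector 2) (p : nat) : multicovector p.*2 :=
  if p is p'.+1 then wedge b (@wedge_pow b p') else fun _ => 1.

Definition covec1 (a : E -> R) : multicovector 1 := fun v => a (v ord0).
Definition covec2 (b : E -> E -> R) : multicovector 2 :=
  fun v => b (v ord0) (v ord_max).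

End Tensors.

Section Contact.
Variables (R : realType) (p : nat).
Notation E := 'rV[R]_(p.*2.+1).

Definition contact_form (eta : E -> E -> R) : Prop :=
  one_form eta /\
  forall q, exists v : 'I_(1 + p.*2) -> E,
    wedge (covec1 (eta q)) (@wedge_pow R p.*2.+1 (covec2 (ext_d eta q)) p) v != 0.

Definition reeb_field (eta : E -> E -> R) (xi : E -> E) : Prop :=
  [/\ vector_field xi,
      forall q, eta q (xi q) = 1
    & forall q v, ext_d eta q (xi q) v = 0].

Definition contact_riemannian (eta : E -> E -> R) (xi : E -> E)
    (phi : E -> E -> E) (g : E -> E -> E -> R) : Prop :=
  [/\ contact_form eta /\ reeb_field eta xi,
      endomorphism_field phi /\ riemannian_metric g,
      forall U, vector_field U -> forall q, eta q (U q) = g q (U q) (xi q),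
      forall U V, vector_field U -> vector_field V -> forall q,
        2^-1 * ext_d eta q (U q) (V q) = g q (phi q (U q)) (V q)
    & forall U, vector_field U -> forall q,
        phi q (phi q (U q)) = - U q + eta q (U q) *: xi q].

End Contact.

Section Heisenberg.
Variable R : realType.

(* (z, t) is encoded by the row of its real coordinates (Re z, Im z, t). *)
Notation heis := 'rV[R]_3.

Implicit Types q u v : heis.

Definition row3 (a b c : R) : heis := \row_(i < 3) [:: a; b; c]`_i.

Definition cx q : R := q 0 0.
Definition cy q : R := q 0 1.
Definition ct q : R := q 0 (@ord_max 2).

(* Im (z * conj w) = y * x' - x * y' for z = x + iy and w = x' + iy'. *)
Definition heis_mul q q' : heis :=
  row3 (cx q + cx q') (cy q + cy q')
       (ct q + ct q' + 2 * (cy q * cx q' - cx q * cy q')).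

Definition pd_x : heis := row3 1 0 0.
Definition pd_y : heis := row3 0 1 0.
Definition pd_t : heis := row3 0 0 1.

Definition heisX q : heis := pd_x + (2 * cy q) *: pd_t.
Definition heisY q : heis := pd_y - (2 * cx q) *: pd_t.
Definition heisT q : heis := pd_t.
Definition heisTL (L : R) q : heis := (Num.sqrt L)^-1 *: heisT q.

(* On a tangent vector v, dx, dy and dt are the coordinates of v. *)
Definition omega q v : R := ct v + 2 * cx q * cy v - 2 * cy q * cx v.

Definition heis_metric (L : R) q u v : R :=
  cx u * cx v + cy u * cy v + L * (omega q u * omega q v).

(* v = dx(v) X + dy(v) Y + omega(v) T, so this is the linear map with
   phi X = Y, phi Y = - X and phi T_L = 0: see heis_phi_unique. *)
Definition heis_phi q v : heis := cx v *: heisY q - cy v *: heisX q.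

Lemma derive_affine (V W : normedModType R) (f : V -> W) (a v : V) (w : W) :
  (forall h : R, f (h *: v + a) - f a = h *: w) -> 'D_v f a = w.
Proof.
move=> fw; apply/cvg_lim => //; apply: cvg_near_cst.
near=> h; rewrite /= fw scalerA mulVf ?scale1r //.
by near: h; exact: nbhs_dnbhs_neq.
Unshelve. all: by end_near. Qed.

Lemma row3E a b c : (cx (row3 a b c) = a) * (cy (row3 a b c) = b) *
  (ct (row3 a b c) = c).
Proof. by rewrite /cx /cy /ct !mxE. Qed.

Lemma row3P u v : cx u = cx v -> cy u = cy v -> ct u = ct v -> u = v.
Proof.
move=> h0 h1 h2; apply/rowP => -[[|[|[|//]]] i3].
- by rewrite (_ : Ordinal i3 = 0) //; apply/val_inj.
- by rewrite (_ : Ordinal i3 = 1) //; apply/val_inj.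
- by rewrite (_ : Ordinal i3 = ord_max) //; apply/val_inj.
Qed.

Lemma coordD u v : (cx (u + v) = cx u + cx v) * (cy (u + v) = cy u + cy v) *
  (ct (u + v) = ct u + ct v).
Proof. by rewrite /cx /cy /ct !mxE. Qed.

Lemma coordN u : (cx (- u) = - cx u) * (cy (- u) = - cy u) *
  (ct (- u) = - ct u).
Proof. by rewrite /cx /cy /ct !mxE. Qed.

Lemma coordZ (a : R) u : (cx (a *: u) = a * cx u) * (cy (a *: u) = a * cy u) *
  (ct (a *: u) = a * ct u).
Proof. by rewrite /cx /cy /ct !mxE. Qed.

Definition coordE := (coordD, coordN, coordZ, row3E).

Lemma heis_frame q v :
  v = cx v *: heisX q + cy v *: heisY q + omega q v *: heisT q.
Proof.
by apply: row3P; rewrite /heisX /heisY /heisT /omega /pd_x /pd_y /pd_t !coordE;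
  ring.
Qed.

Lemma heis_phi_unique (L : R) (phi : heis -> heis -> heis) : 0 < L ->
  (forall q, linear (phi q)) ->
  (forall q, [/\ phi q (heisX q) = heisY q, phi q (heisY q) = - heisX q
               & phi q (heisTL L q) = 0]) <->
  (forall q v, phi q v = heis_phi q v).
Proof.
move=> L0 philin; split=> [phiE q v | phiE q].
  have phi0 : phi q 0 = 0.
    by have := philin q (-1) 0 0; rewrite scaler0 addr0 scaleN1r addNr.
  have [pX pY pT] := phiE q.
  have s0 : Num.sqrt L != 0 by rewrite sqrtr_eq0 -ltNge.
  have -> : v = cx v *: heisX q + (cy v *: heisY q +
      ((omega q v * Num.sqrt L) *: heisTL L q + 0)).
    rewrite addr0 /heisTL scalerA mulfK // addrA; exact: heis_frame.
  rewrite !philin pX pY pT phi0 /heis_phi.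
  by apply: row3P; rewrite /heisTL /heisX /heisY /heisT /omega /pd_x /pd_y /pd_t
    ?coordE /cx /cy /ct ?mxE /=; ring.
by rewrite !phiE /heis_phi; split; apply: row3P;
  rewrite /heisTL /heisX /heisY /heisT /pd_x /pd_y /pd_t !coordE
    ?[cx 0]mxE ?[cy 0]mxE ?[ct 0]mxE; ring.
Qed.

Lemma heis_metric_orthonormal (L : R) q : 0 < L ->
  [/\ heis_metric L q (heisX q) (heisX q) = 1,
      heis_metric L q (heisY q) (heisY q) = 1
    & heis_metric L q (heisTL L q) (heisTL L q) = 1] /\
  [/\ heis_metric L q (heisX q) (heisY q) = 0,
      heis_metric L q (heisX q) (heisTL L q) = 0
    & heis_metric L q (heisY q) (heisTL L q) = 0].
Proof.
move=> L0.
have s0 : Num.sqrt L != 0 by rewrite sqrtr_eq0 -ltNge.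
have sL : L = Num.sqrt L ^+ 2 by rewrite sqr_sqrtr // ltW.
rewrite /heis_metric /omega /heisTL /heisX /heisY /heisT /pd_x /pd_y /pd_t.
move: (Num.sqrt L) s0 sL => s s0 ->.
by split; split; rewrite !coordE; field.
Qed.

Lemma ext_d_omega q u v :
  ext_d (@omega) q u v = 4 * (cx u * cy v - cy u * cx v).
Proof.
have dE w w' : 'D_w (fun x => omega x w' : R^o) q =
    2 * cx w * cy w' - 2 * cy w * cx w'.
  by apply: derive_affine => h; rewrite /omega !coordE /GRing.scale /=; ring.
by rewrite /ext_d !dE; ring.
Qed.

Lemma heis_left_invariant p q :
  [/\ 'D_(heisX q) (heis_mul p) q = heisX (heis_mul p q),
      'D_(heisY q) (heis_mul p) q = heisY (heis_mul p q)
    & 'D_(heisT q) (heis_mul p) q = heisT (heis_mul p q)].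
Proof.
by split; apply: derive_affine => h; apply: row3P;
  rewrite /heisX /heisY /heisT /heis_mul /pd_x /pd_y /pd_t !coordE; ring.
Qed.

End Heisenberg.

(* Main.v *)
Require Import Defs.
From mathcomp Require Import all_boot all_order all_algebra all_fingroup.
From mathcomp Require Import all_classical all_reals all_analysis.
From mathcomp Require Import ring lra.
Import Order.TTheory GRing.Theory Num.Theory.
Import numFieldNormedType.Exports.
Local Open Scope ring_scope.

(** Write s = sqrt L and eta = s omega.  Everything in the definition of a
    contact Riemannian structure holds for every L > 0, except the condition
    (1/2) d eta (U, V) = g_L (phi U, V).  That condition compares two multiples
    of the same 2-form dx /\ dy: since d omega = 4 dx /\ dy, the left side is
    2 s (dx /\ dy)(U, V) ([ext_d_eta]), whereas phi U has no T-component and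
    phi rotates the horizontal plane by a right angle, so the right side is
    (dx /\ dy)(U, V) whatever L is ([heis_metric_phi]).  The two agree exactly
    when 2 s = 1, that is L = 1/4 ([half_ext_d_eta_iff]).

    Of the conditions that hold for every L, two need an argument.  The form
    eta /\ d eta vanishes nowhere because, d eta being a multiple of a wedge of
    two covectors, its value on three vectors is a multiple of a 3 x 3
    determinant ([wedge_covec1_covec2]), and on the frame (d/dt, X, Y) the
    matrix is triangular with diagonal (s, 1, 1).  Smoothness of the tensors
    holds because their components are polynomials in the coordinates, built
    with [smooth_cst], [smooth_coord], [smoothD], [smoothN] and [smoothM]. *)

(** * Smooth functions on a coordinate space *)

Section Smooth.
Variables (R : realType) (n : nat).
Implicit Types (f g : 'rV[R]_n -> R) (k : nat).

(** The partial derivatives may be given in closed form; this hides the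
    function extensionality needed to substitute them under [Ck]. *)
Lemma CkS_intro k f (df : 'I_n -> 'rV[R]_n -> R) :
  (forall q, differentiable f q) ->
  (forall i q, 'D_(delta_mx 0 i) f q = df i q) ->
  (forall i, Ck k (df i)) -> Ck k.+1 f.
Proof.
move=> difff dfE Ckdf; split=> // i.
have -> : (fun q => 'D_(delta_mx 0 i) f q) = df i by apply/funext => q.
exact: Ckdf.
Qed.

Lemma CkW k f : Ck k.+1 f -> Ck k f.
Proof.
elim: k f => [|k IHk] f [df Df].
  by move=> q; exact: differentiable_continuous.
by split=> // i; exact: IHk.
Qed.

Lemma Ck_cst k (c : R) : Ck k (fun _ : 'rV[R]_n => c).
Proof.
elim: k c => [|k IHk] c; first by move=> q; exact: cst_continuous.
apply: (@CkS_intro _ _ (fun _ _ => 0)) => // i q; exact: derive_cst.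
Qed.

Lemma Ck_coord k (j : 'I_n) : Ck k (fun q : 'rV[R]_n => q 0 j).
Proof.
case: k => [|k]; first exact: coord_continuous.
apply: (@CkS_intro _ _ (fun i _ => (delta_mx 0 i : 'rV[R]_n) 0 j)) => [q|i q|i].
- exact: differentiable_coord.
- by apply: derive_affine => h; rewrite !mxE addrK.
- exact: Ck_cst.
Qed.

Lemma CkD k f g : Ck k f -> Ck k g -> Ck k (fun q => f q + g q).
Proof.
elim: k f g => [|k IHk] f g.
  by move=> cf cg q; exact: continuousD (cf q) (cg q).
move=> [df Df] [dg Dg].
apply: (@CkS_intro _ _
    (fun i q => 'D_(delta_mx 0 i) f q + 'D_(delta_mx 0 i) g q)) => [q|i q|i].
- exact: differentiableD.
- by apply: deriveD; exact: diff_derivable.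
- exact: IHk (Df i) (Dg i).
Qed.

(** The Leibniz rule puts the undifferentiated factors into the derivative, so
    the induction has to use [CkW] to lower their order. *)
Lemma CkM k f g : Ck k f -> Ck k g -> Ck k (fun q => f q * g q).
Proof.
elim: k f g => [|k IHk] f g.
  by move=> cf cg q; exact: continuousM (cf q) (cg q).
move=> Cf Cg; have [[df Df] [dg Dg]] := (Cf, Cg).
apply: (@CkS_intro _ _ (fun i q =>
    f q * 'D_(delta_mx 0 i) g q + g q * 'D_(delta_mx 0 i) f q)) => [q|i q|i].
- exact: differentiableM.
- by apply: deriveM; exact: diff_derivable.
- apply: CkD.
    exact: IHk (CkW _ _ Cf) (Dg i).
  exact: IHk (CkW _ _ Cg) (Df i).
Qed.

Lemma smooth_cst (c : R) : smooth (fun _ : 'rV[R]_n => c).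
Proof. by move=> k; exact: Ck_cst. Qed.

Lemma smooth_coord (j : 'I_n) : smooth (fun q : 'rV[R]_n => q 0 j).
Proof. by move=> k; exact: Ck_coord. Qed.

Lemma smoothD f g : smooth f -> smooth g -> smooth (fun q => f q + g q).
Proof. by move=> sf sg k; exact: CkD. Qed.

Lemma smoothM f g : smooth f -> smooth g -> smooth (fun q => f q * g q).
Proof. by move=> sf sg k; exact: CkM. Qed.

Lemma smoothN f : smooth f -> smooth (fun q => - f q).
Proof.
move=> sf; have -> : (fun q => - f q) = (fun q => -1 * f q).
  by apply/funext => q; rewrite mulN1r.
exact/smoothM/sf/smooth_cst.
Qed.

Lemma cst_vector_field (u : 'rV[R]_n) : vector_field (fun=> u).
Proof. by move=> j; exact: smooth_cst. Qed.

End Smooth.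

Ltac smooth_poly :=
  repeat first [ exact: smooth_cst | exact: smooth_coord | apply: smoothD
               | apply: smoothN | apply: smoothM ].

(** * Wedge products of covectors as determinants *)

Section WedgeDet.
Variables (R : realType) (n : nat).
Notation E := 'rV[R]_n.
Implicit Types (a f h : E -> R) (b : E -> E -> R) (c : R).

Lemma det2E (A : 'M[R]_2) : \det A = A 0 0 * A 1 1 - A 0 1 * A 1 0.
Proof.
have l01 : lift ord0 0 = 1 :> 'I_2 by exact/val_inj.
have l10 : lift 1 0 = 0 :> 'I_2 by exact/val_inj.
rewrite (expand_det_row _ 0) !big_ord_recl big_ord0 /cofactor !det_mx11 !mxE.
rewrite !l01 !l10 /= expr0 expr1.
by ring.
Qed.

(** Wedging with the empty power averages b over the two orders of its
    arguments, with signs.  For b = c f /\ h each term is a difference of two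
    products, and the signed sums of these are Leibniz formulas for the
    determinants with rows (f, h) and (h, f). *)
Lemma wedge_pow1 b c f h :
  (forall u w, b u w = c * (f u * h w - h u * f w)) ->
  @wedge_pow R n (covec2 b) 1 = covec2 b.
Proof.
move=> bE; apply/funext => v.
pose M f h := \matrix_(i < 2, j < 2) [:: f; h]`_i (v j).
have -> : covec2 b v = 2^-1 * (c * (\det (M f h) - \det (M h f))).
  have m1 : ord_max = 1 :> 'I_2 by exact/val_inj.
  by rewrite /covec2 bE !det2E !mxE /= m1; field.
rewrite /= /wedge; congr (_ * _).
rewrite -sumrB mulr_sumr; apply: eq_bigr => s _.
rewrite /covec2 bE !big_ord_recl !big_ord0 !mxE /= !mulr1.
have -> : lshift 0.*2 (@ord0 1) = @ord0 1 by exact/val_inj.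
have -> : lshift 0.*2 (@ord_max 1) = lift (@ord0 1) ord0 by exact/val_inj.
by rewrite -mulrBr mulrCA.
Qed.

(** Same mechanism: the signed sum over the permutations of three vectors is
    the difference of the determinants with rows (a, f, h) and (a, h, f), which
    are opposite, and the resulting factor 2 cancels the normalization. *)
Lemma wedge_covec1_covec2 a b c f h :
  (forall u w, b u w = c * (f u * h w - h u * f w)) ->
  forall v : 'I_3 -> E, wedge (covec1 a) (covec2 b) v =
    c * \det (\matrix_(i < 3, j < 3) [:: a; f; h]`_i (v j)).
Proof.
move=> bE v.
pose M f h := \matrix_(i < 3, j < 3) [:: a; f; h]`_i (v j).
have detN : \det (M h f) = - \det (M f h).
  have -> : M h f = xrow 1 ord_max (M f h).
    apply/matrixP => i j; rewrite !mxE permE /=.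
    by case: i => -[|[|[|//]]] ?.
  by rewrite xrowE det_mulmx det_perm odd_tperm /= expr1 mulN1r.
have -> : c * \det (M f h) = 2^-1 * (c * (\det (M f h) - \det (M h f))).
  by rewrite detN; field.
rewrite /= /wedge mul1n; congr (_ * _).
rewrite -sumrB mulr_sumr; apply: eq_bigr => s _.
rewrite /covec1 /covec2 bE !big_ord_recl !big_ord0 !mxE /= !mulr1.
have -> : lshift 2 (@ord0 0) = @ord0 2 by exact/val_inj.
have -> : rshift 1 (@ord0 1) = lift (@ord0 2) ord0 by exact/val_inj.
have -> : rshift 1 (@ord_max 1) = lift (@ord0 2) (lift ord0 ord0).
  exact/val_inj.
by rewrite -!mulrBr mulrCA -mulrA.
Qed.

End WedgeDet.

(** * The Heisenberg group *)

Section HeisenbergContact.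
Variables (R : realType) (L : R).
Hypothesis L_gt0 : 0 < L.
Notation heis := 'rV[R]_3.
Notation s := (Num.sqrt L).
Notation eta := (fun q v : heis => s * omega q v).

Let s_gt0 : 0 < s. Proof. by rewrite sqrtr_gt0. Qed.
Let s_neq0 : s != 0. Proof. by rewrite gt_eqF. Qed.
Let sqr_s : s ^+ 2 = L. Proof. by rewrite sqr_sqrtr // ltW. Qed.

Lemma ext_d_eta q u v : ext_d eta q u v = 4 * s * (cx u * cy v - cy u * cx v).
Proof.
have dE w w' : 'D_w (fun x => s * omega x w' : R^o) q =
    s * (2 * cx w * cy w' - 2 * cy w * cx w').
  by apply: derive_affine => h; rewrite /omega !coordE /GRing.scale /=; ring.
by rewrite /ext_d !dE; ring.
Qed.

(** On the frame (d/dt, X, Y) the covectors omega, dx and dy give a triangular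
    matrix, since X and Y are horizontal. *)
Lemma eta_contact_form : @contact_form R 1 eta.
Proof.
split; first split.
- by move=> q k u v; rewrite /omega !coordE /GRing.scale /=; ring.
- by move=> v; rewrite /omega /cx /cy /ct; smooth_poly.
move=> q.
exists (fun i => [:: pd_t R; heisX q; heisY q]`_i).
rewrite (wedge_pow1 _ _ _ _ _ _ (ext_d_eta q)).
rewrite (wedge_covec1_covec2 _ _ _ _ _ _ _ (ext_d_eta q)).
rewrite det_trig.
  rewrite !big_ord_recl big_ord0 !mxE /= /omega /heisX /heisY /pd_t /pd_x /pd_y.
  rewrite !coordE; apply/lt0r_neq0.
  by rewrite !(mulr0, subr0, addr0, mulr1) !mulr_gt0.
apply/is_trig_mxP => -[[|[|[|//]]] ?] [[|[|[|//]]] ?] //= _; rewrite !mxE /=;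
  by rewrite /omega /heisX /heisY /pd_t /pd_x /pd_y !coordE; ring.
Qed.

Lemma TL_reeb_field : @reeb_field R 1 eta (heisTL L).
Proof.
split=> [|q|q v]; first exact: (cst_vector_field _ _ (heisTL L 0)).
- by rewrite /omega /heisTL /heisT /pd_t !coordE; field.
- by rewrite ext_d_eta /heisTL /heisT /pd_t !coordE; ring.
Qed.

Lemma heis_phi_endomorphism : endomorphism_field (@heis_phi R).
Proof.
split=> [q k u v|v j].
  by apply: row3P; rewrite /heis_phi /heisX /heisY /pd_t /pd_x /pd_y !coordE;
    ring.
rewrite /heis_phi /heisX /heisY /pd_t /pd_x /pd_y /cx /cy.
pose e a b c : heis := row3 a b c.
have -> : (fun q : heis => (v 0 0 *: (e 0 1 0 - (2 * q 0 0) *: e 0 0 1) -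
      v 0 1 *: (e 1 0 0 + (2 * q 0 1) *: e 0 0 1)) 0 j) =
    (fun q => v 0 0 * (e 0 1 0 0 j - (2 * q 0 0) * e 0 0 1 0 j) -
      v 0 1 * (e 1 0 0 0 j + (2 * q 0 1) * e 0 0 1 0 j)).
  by apply/funext => q; rewrite !mxE.
by smooth_poly.
Qed.

Lemma heis_metric_riemannian : riemannian_metric (heis_metric L).
Proof.
split.
- by move=> q u k v w; rewrite /heis_metric /omega !coordE /GRing.scale /=; ring.
- by move=> q u v; rewrite /heis_metric; ring.
- move=> q u u_neq0.
  have xy_ge0 : 0 <= cx u ^+ 2 + cy u ^+ 2 by rewrite addr_ge0 ?sqr_ge0.
  have w_ge0 : 0 <= L * omega q u ^+ 2 by rewrite mulr_ge0 ?sqr_ge0 ?ltW.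
  rewrite /heis_metric -!expr2 lt0r (addr_ge0 xy_ge0 w_ge0) andbT.
  apply: contra_neq u_neq0 => /eqP.
  rewrite (paddr_eq0 xy_ge0 w_ge0) paddr_eq0 ?sqr_ge0 //.
  rewrite [L * _ == 0]mulf_eq0 (gt_eqF L_gt0) /= !sqrf_eq0.
  move=> /andP[/andP[/eqP x0 /eqP y0] /eqP w0].
  by rewrite (heis_frame q u) x0 y0 w0 !scale0r !addr0.
- by move=> u v; rewrite /heis_metric /omega /cx /cy /ct; smooth_poly.
Qed.

Lemma eta_metric_dual q u : eta q u = heis_metric L q u (heisTL L q).
Proof.
rewrite /heis_metric /omega /heisTL /heisT /pd_t !coordE.
by move: s_neq0 sqr_s; move: s => r r_neq0 <-; field.
Qed.

Lemma heis_phi_sqr q u :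
  heis_phi q (heis_phi q u) = - u + eta q u *: heisTL L q.
Proof.
apply: row3P;
  rewrite /heis_phi /omega /heisTL /heisT /heisX /heisY /pd_t /pd_x /pd_y !coordE;
  by field.
Qed.

Lemma heis_metric_phi q u v :
  heis_metric L q (heis_phi q u) v = cx u * cy v - cy u * cx v.
Proof.
rewrite /heis_metric /heis_phi /omega /heisX /heisY /pd_t /pd_x /pd_y !coordE.
by ring.
Qed.

(** Necessity is already visible on the pair d/dx, d/dy at the origin. *)
Lemma half_ext_d_eta_iff :
  (forall q u v : heis,
     2^-1 * ext_d eta q u v = heis_metric L q (heis_phi q u) v) <-> L = 1 / 4.
Proof.
split=> [compat|L14 q u v].
  have := compat 0 (pd_x R) (pd_y R).
  rewrite ext_d_eta heis_metric_phi /pd_x /pd_y !coordE => s2.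
  have {}s2 : s = 2^-1 by lra.
  by rewrite -sqr_s s2; field.
have s2 : s = 2^-1.
  by rewrite L14 (_ : 1 / 4 = 2^-1 ^+ 2) ?sqrtr_sqr ?gtr0_norm //; field.
by rewrite ext_d_eta heis_metric_phi s2; field.
Qed.

End HeisenbergContact.

Theorem mainTheorem5 (R : realType) (L : R) (hL : 0 < L) :
  @contact_riemannian R 1
    (fun q v => Num.sqrt L * omega q v) (heisTL L) (@heis_phi R) (heis_metric L)
  <-> L = 1 / 4.
Proof.
rewrite -half_ext_d_eta_iff //; split=> [[_ _ _ compat _] q u v|compat].
  exact: (compat _ _ (cst_vector_field _ _ u) (cst_vector_field _ _ v) q).
split.
- split; [exact: eta_contact_form | exact: TL_reeb_field].
- split; [exact: heis_phi_endomorphism | exact: heis_metric_riemannian].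
- by move=> U _ q; exact: eta_metric_dual.
- by move=> U V _ _ q; exact: compat.
- by move=> U _ q; exact: heis_phi_sqr.
Qed.
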